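(* Let $f_{\mathrm{sw}}^s$ be the solution of the semi-discrete Vlasov-Poisson equations in the symmetrically weighted (SW) formulation, as given in the context. Then the total momentum $\mathcal{P}(t)=\sum_sm^s\int_0^\ell\int_{\mathbb{R}}v\,f_{\mathrm{sw}}^s(x,v,t)\,\mathrm{d}v\,\mathrm{d}x$ is conserved in time if $N_v$ is even and $u^s=0$ for all $s$, and its drift rate is $$\frac{\mathrm{d}\mathcal{P}}{\mathrm{d}t}=\begin{cases}-\Delta x\,N_v\,\mathcal{I}_{N_v-1}\,\mathbf{E}(t)^\top\sum_s\alpha^sq^s\,\mathbf{C}^s_{N_v-1}(t)&\text{if }N_v\text{ is odd},\\[2pt]-\Delta x\sqrt{\dfrac{N_v-1}{2}}\;\mathcal{I}_{N_v-2}\,\mathbf{E}(t)^\top\sum_su^sq^s\,\mathbf{C}^s_{N_v-1}(t)&\text{if }N_v\text{ is even}.\end{cases}$$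
   Context: Finitely many species $s$ have constants $q^s,u^s\in\mathbb{R}$ and $m^s,\alpha^s>0$; $N_v\ge1$ is the number of velocity modes. The spatial domain $[0,\ell]$ is periodic, with a uniform grid $x^{(1)},\dots,x^{(N_x)}$, spacing $\Delta x=\ell/N_x$. Basis: $\psi_n(\xi)=(\sqrt\pi2^nn!)^{-1/2}\mathcal H_n(\xi)e^{-\xi^2/2}$ with physicists' Hermite polynomials $\mathcal H_n$, $\xi^s=(v-u^s)/\alpha^s$; $\mathcal{I}_n=\int_{\mathbb R}\psi_n(\xi)\,\mathrm d\xi$. $\mathbf{D}^p\in\mathbb{R}^{N_x\times N_x}$ is the periodic centered finite difference matrix of even order $p$ ($N_x>p$): the circulant matrix $\mathbf{D}^p_{jk}=d^p_{(k-j)\bmod N_x}$ with $d_0^p=0$; for $1\le k\le p/2=:r$, $d_k^p=\frac{1}{\Delta x}\frac{(-1)^{k+1}(r!)^2}{k(r-k)!(r+k)!}$ and $d_{N_x-k}^p=-d_k^p$; all other $d_k^p=0$. Semi-discrete SW system: differentiable functions $\mathbf{C}_n^s(t)\in\mathbb{R}^{N_x}$ ($0\le n\le N_v-1$; convention $\mathbf C_{-1}^s=\mathbf C_{N_v}^s=0$) and $\mathbf E(t)\in\mathbb{R}^{N_x}$ with $$\frac{\mathrm d\mathbf C_n^s}{\mathrm dt}=-\mathbf D^p\Big(\alpha^s\sqrt{\tfrac n2}\,\mathbf C_{n-1}^s+\alpha^s\sqrt{\tfrac{n+1}2}\,\mathbf C_{n+1}^s+u^s\mathbf C_n^s\Big)+\frac{q^s}{m^s\alpha^s}\mathbf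 E\odot\Big(\sqrt{\tfrac n2}\,\mathbf C_{n-1}^s-\sqrt{\tfrac{n+1}2}\,\mathbf C_{n+1}^s\Big),$$ $$\mathbf D^p\mathbf E(t)=\sum_sq^s\alpha^s\sum_{n=0}^{N_v-1}\mathcal I_n\mathbf C_n^s(t),\qquad \mathbf 1^\top\mathbf E(t)=0,$$ where $\odot$ is the entrywise product and $\mathbf 1$ the all-ones vector. The solution is $f^s_{\mathrm{sw}}(x^{(j)},v,t)=\sum_{n=0}^{N_v-1}(\mathbf C_n^s(t))_j\,\psi_n(\xi^s)$. All integrals over $x$ are evaluated by the periodic trapezoidal rule $\int_0^\ell g\,\mathrm dx:=\Delta x\sum_jg(x^{(j)})$, so $\mathcal P(t)=\Delta x\sum_sm^s\alpha^s\sum_{n=0}^{N_v-1}\mathcal I_n^{1,s}\,\mathbf 1^\top\mathbf C_n^s(t)$ with $\mathcal I_n^{1,s}=\int_{\mathbb R}(\alpha^s\xi+u^s)\psi_n(\xi)\,\mathrm d\xi$. *)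

(* Defs.v *)
From HB Require Import structures.
From mathcomp Require Import all_boot all_order all_algebra.
From mathcomp Require Import all_classical all_reals all_analysis.
Set Implicit Arguments.
Unset Strict Implicit.
Unset Printing Implicit Defensive.
Import Order.TTheory GRing.Theory Num.Theory.
Import numFieldNormedType.Exports.
Local Open Scope classical_set_scope.
Local Open Scope ring_scope.

Section HermiteBasis.
Context {R : realType}.

(* Physicists' Hermite polynomials, by the Rodrigues formula. *)
Definition hermite (n : nat) (x : R) : R :=
  (-1) ^+ n * expR (x ^+ 2) * ((fun y : R => expR (- y ^+ 2))^`(n))%classic x.

Definition psi (n : nat) (xi : R) : R :=
  (Num.sqrt (Num.sqrt pi * 2 ^+ n * (n`!)%:R))^-1
  * hermite n xi * expR (- xi ^+ 2 / 2).

Definition psi_int (n : nat) : R := \int[lebesgue_measure]_xi psi n xi.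

End HermiteBasis.

Section CenteredDifference.
Context {R : realType}.
Variables (p Nx : nat) (dx : R).

(* The stencil vector d_0, ..., d_(Nx - 1); the cases are exclusive when
   p < Nx. *)
Definition fd_coef (k : nat) : R :=
  let r := p./2 in
  let w (i : nat) : R :=
    dx^-1 * (((-1) ^+ i.+1 * (r`!)%:R ^+ 2)
             / (i%:R * ((r - i)`!)%:R * ((r + i)`!)%:R)) in
  if (1 <= k <= r)%N then w k
  else if (1 <= Nx - k <= r)%N then - w (Nx - k)%N
  else 0.

(* Adding Nx before the truncated subtraction makes this (k - j) mod Nx. *)
Definition fd_mx : 'M[R]_Nx :=
  \matrix_(j < Nx, k < Nx) fd_coef ((k + Nx - j) %% Nx).

End CenteredDifference.

Section SWSystem.
Context {R : realType} {S : finType}.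
Variables (q m u alpha : S -> R) (Nv p Nx : nat) (l : R).

Definition grid_dx : R := l / Nx%:R.

(* Mode indices are integers so that the boundary conventions
   C_(-1) = C_Nv = 0 can be imposed literally; no other index outside
   0, ..., Nv - 1 is ever used. *)
Variables (C : S -> int -> R -> 'cV[R]_Nx) (E : R -> 'cV[R]_Nx).

Definition sw_rhs (s : S) (n : nat) (t : R) : 'cV[R]_Nx :=
  - (fd_mx p Nx grid_dx *m
      ((alpha s * Num.sqrt (n%:R / 2)) *: C s (n%:Z - 1) t
       + (alpha s * Num.sqrt (n.+1%:R / 2)) *: C s (n%:Z + 1) t
       + u s *: C s n%:Z t))
  + (q s / (m s * alpha s)) *:
      map2_mx *%R (E t)
        (Num.sqrt (n%:R / 2) *: C s (n%:Z - 1) t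
         - Num.sqrt (n.+1%:R / 2) *: C s (n%:Z + 1) t).

Record sw_solution (J : interval R) : Prop := SWSolution {
  sw_modeN1 : forall s t, t \in J -> C s (-1) t = 0;
  sw_modeNv : forall s t, t \in J -> C s Nv%:Z t = 0;
  sw_vlasov : forall s (n : nat) t, (n < Nv)%N -> t \in J ->
    is_derive t (1 : R) (C s n%:Z) (sw_rhs s n t);
  sw_poisson : forall t, t \in J ->
    fd_mx p Nx grid_dx *m E t =
      \sum_s (q s * alpha s) *: (\sum_(n < Nv) psi_int n *: C s n%:Z t);
  sw_gauge : forall t, t \in J -> (const_mx 1 : 'cV[R]_Nx)^T *m E t = 0
}.

(* f_sw^s at the j-th grid point, velocity v and time t. *)
Definition f_sw (s : S) (j : 'I_Nx) (v t : R) : R :=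
  \sum_(n < Nv) C s n%:Z t j 0 * psi n ((v - u s) / alpha s).

(* The x-integral is the periodic trapezoidal rule on the grid. *)
Definition sw_momentum (t : R) : R :=
  \sum_s m s *
    (grid_dx *
     \sum_(j < Nx) \int[lebesgue_measure]_v (v * f_sw s j v t)).

End SWSystem.

(* Main.v *)
Require Import Defs.
From HB Require Import structures.
From mathcomp Require Import all_boot all_order all_algebra.
From mathcomp Require Import all_classical all_reals all_analysis.
From mathcomp Require Import measurable_realfun zify ring lra.
Set Implicit Arguments.
Unset Strict Implicit.
Unset Printing Implicit Defensive.
Import Order.TTheory GRing.Theory Num.Theory.
Import numFieldNormedType.Exports.
Local Open Scope classical_set_scope.
Local Open Scope ring_scope.

(** The rate of change of the momentum is computed mode by mode.

    Every Hermite function is a polynomial times [exp (- x^2 / 2)], and the only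
    analytic fact needed about the integrals of such functions is integration by
    parts, [gauss_int_deriv]: a polynomial [P] satisfies [L(P') = L(X P)], where
    [L] integrates against the Gaussian. With [a_n = sqrt (n / 2)] and [I_n] the
    integral of [psi n], it yields [a_n I_(n-1) = a_(n+1) I_(n+1)]
    ([psi_int_rec]), hence [I_n = 0] for odd [n] ([psi_int_odd]), and it evaluates
    the first moments [K_n], the integrals of [(alpha xi + u) psi_n]. After an
    affine change of the velocity variable, the momentum is a linear combination,
    with the coefficients [K_n], of the grid sums of the [C_n]
    ([integral_velocity_psi], [sw_momentumE]).

    When the equation of motion is summed over the periodic grid, the advection
    term disappears since the columns of the difference matrix [D] sum to 0
    ([sum_fd_mx_col]). What remains is the electric field paired with
    [sum_n K_n (a_n C_(n-1) - a_(n+1) C_(n+1))]. A summation by parts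
    ([sum_first_moment_ladder]) turns this into [alpha sum_n I_n C_n], because
    [a_(n+1) K_(n+1) - a_n K_(n-1) = alpha I_n], minus the truncation term
    [a_Nv K_Nv C_(Nv-1)]. Summed over the species, the first part is the charge
    density, that is [D E] by the Poisson equation, and [E^T D E = 0] because [D]
    is antisymmetric ([fd_mx_quad0]). Only the truncation term survives: one of
    [I_Nv] and the first moment of [psi_Nv] is 0 according to the parity of [Nv],
    and the other one gives the corresponding case of the drift rate. For even
    [Nv] it is proportional to [u], so that the derivative vanishes when all [u]
    are 0, and the momentum is constant by the mean value theorem. *)

(** * Polynomials times a Gaussian *)

Section GaussianPolynomials.
Context {R : realType}.
Implicit Types (P Q : {poly R}) (x : R).
Let mu := @lebesgue_measure R.

Definition gauss_poly P x : R := P.[x] * expR (- x ^+ 2 / 2).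

(** Differentiation stays inside this class of functions, so that identities
    between the integrals of Hermite functions become identities between
    polynomials. *)
Lemma is_derive_gauss_poly P x :
  is_derive x (1 : R) (gauss_poly P) (gauss_poly (P^`() - 'X * P) x).
Proof.
rewrite /gauss_poly; apply: trigger_derive.
rewrite !scaler1 /GRing.scale /= !hornerE/=.
by field.
Qed.

Lemma continuous_gauss_poly P : continuous (gauss_poly P).
Proof.
move=> x; apply/differentiable_continuous/derivable1_diffP.
by have [] := is_derive_gauss_poly P x.
Qed.

(** Multiplying by the variable costs half of the exponent: [|x| <= 1 + x^2] and
    [x^2] is at most a constant times [exp (a x^2 / 2)]. This is why the rate [a]
    stays arbitrary in the induction on the polynomial. *)
Lemma horner_le_expR P (a : R) : 0 < a ->
  exists2 c : R, 0 <= c & forall x, `|P.[x]| <= c * expR (a * x ^+ 2).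
Proof.
elim/poly_ind: P a => [|P b IH] a a0.
  by exists 0 => // x; rewrite horner0 normr0 mul0r.
have a20 : 0 < a / 2 by lra.
have [c c0 Pc] := IH _ a20.
exists (c * (1 + (a / 2)^-1) + `|b|).
  by rewrite addr_ge0// mulr_ge0// addr_ge0// invr_ge0 ltW.
move=> x; rewrite hornerMXaddC mulrDl (le_trans (ler_normD _ _))//.
have x20 := sqr_ge0 x.
apply: lerD; last first.
  rewrite ler_peMr// -expR0 ler_expR mulr_ge0//; exact: ltW.
have -> : a * x ^+ 2 = a / 2 * x ^+ 2 + a / 2 * x ^+ 2 by field.
rewrite expRD mulrACA normrM ler_pM//.
set e := expR _.
have e1 : 1 + a / 2 * x ^+ 2 <= e by exact: expR_ge1Dx.
have ax0 : 0 <= a / 2 * x ^+ 2 by rewrite mulr_ge0// ltW.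
have xe : x ^+ 2 <= (a / 2)^-1 * e.
  by rewrite mulrC ler_pdivlMr// mulrC; lra.
rewrite mulrDl mul1r.
have y_le (y : R) : y <= 1 + y ^+ 2 by have := sqr_ge0 (y - 2^-1); lra.
have := y_le `|x|; rewrite real_normK ?num_real//.
lra.
Qed.

(** The dominating Gaussian has variance 4; any variance above the 1 of the
    weight leaves room for the polynomial. This bound provides both an integrable
    majorant and the decay at infinity. *)
Lemma gauss_poly_bound P :
  exists2 c : R, 0 <= c & forall x, `|gauss_poly P x| <= c * expR (- (x ^+ 2 / 8)).
Proof.
(* 3/8 is what is left when 1/8 is kept out of the exponent 1/2. *)
have a0 : (0 : R) < 3 / 8 by lra.
have [c c0 Pc] := horner_le_expR P a0.
exists c => // x; rewrite /gauss_poly normrM (ger0_norm (expR_ge0 _)).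
have -> : - (x ^+ 2 / 8) = 3 / 8 * x ^+ 2 + - x ^+ 2 / 2 by field.
by rewrite expRD mulrA ler_wpM2r ?expR_ge0.
Qed.

Lemma integrable_gauss_poly P : mu.-integrable setT (EFin \o gauss_poly P).
Proof.
have [c c0 Pc] := gauss_poly_bound P.
have i2 : mu.-integrable setT (fun x => (c * expR (- (x ^+ 2 / 8)))%:E).
  have := integrableZl measurableT (c / normal_peak 2) (integrable_normal_pdf 0 2).
  apply: eq_integrable => // x _ /=.
  rewrite normal_pdfE ?pnatr_eq0// -EFinM /normal_fun subr0.
  rewrite mulrA divfK ?gt_eqF ?normal_peak_gt0 ?pnatr_eq0//.
  by congr (c * expR _)%:E; field.
apply: (le_integrable _ _ _ i2) => //=.
  exact: (measurableT_comp (@EFin_measurable _ _)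
    (continuous_measurable_fun (@continuous_gauss_poly P))).
by move=> x _; rewrite lee_fin (le_trans (Pc x))// ler_norm.
Qed.

(** The fundamental theorem of calculus on [[-n, n]], passed to the limit by
    dominated convergence with [|f|] as the majorant; [f] may change sign. *)
Lemma integral_derivativeT (f F : R -> R) (a b : R) :
  (forall x, is_derive x (1 : R) F (f x)) -> continuous f ->
  mu.-integrable setT (EFin \o f) ->
  F (- n%:R) @[n --> \oo] --> a -> F n%:R @[n --> \oo] --> b ->
  \int[mu]_x f x = b - a.
Proof.
move=> dF cf intf Fa Fb.
pose I (n : nat) : set R := `[- n%:R, n%:R]%classic.
have mf : measurable_fun setT (EFin \o f).
  exact: (measurableT_comp (@EFin_measurable _ _) (continuous_measurable_fun cf)).
have [||||_ _] := @dominated_convergence _ _ _ mu setT measurableT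
   (fun n => (EFin \o f) \_ (I n)) (EFin \o f) (abse \o (EFin \o f)) _ mf.
- by move=> n; apply/(measurable_restrictT _ _).1;
    [exact: measurable_itv|exact: measurable_funTS mf].
- apply: aeW => x _; apply: cvg_near_cst; near=> n.
  rewrite patchE mem_set// /I /= in_itv/= -ler_norml.
  by near: n; exact: nbhs_infty_ger.
- exact: integrable_abse.
- apply: aeW => x n _; rewrite patchE; case: ifP => // _.
  by rewrite abse0 abse_ge0.
move=> cvgI; rewrite /Rintegral.
suff /(cvg_unique _ cvgI) -> :
  (fun n => \int[mu]_x ((EFin \o f) \_ (I n)) x)%E @ \oo --> (b - a)%:E by [].
apply: (@cvg_trans _ ((F n%:R - F (- n%:R))%:E @[n --> \oo])); last first.
  by apply: cvg_EFin; [exact: nearW|exact: cvgB].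
apply: near_eq_cvg; near=> n.
rewrite -integral_mkcond EFinB; symmetry.
have n0 : (0 : R) < n%:R by near: n; exact: nbhs_infty_gtr.
have cF x : {for x, continuous F}.
  by apply/differentiable_continuous/derivable1_diffP; have [] := dF x.
apply: continuous_FTC2.
- by lra.
- exact: continuous_subspaceT.
- split=> [x _||].
  + by have [] := dF x.
  + exact/cvg_at_right_filter/cF.
  + exact/cvg_at_left_filter/cF.
- by move=> x _; rewrite derive1E; apply: derive_val.
Unshelve. all: by end_near. Qed.

(** Covers the two sequences [n] and [-n] at once. *)
Lemma cvg_gauss_poly P (v : nat -> R) : (forall n, v n ^+ 2 = n%:R ^+ 2) ->
  gauss_poly P (v n) @[n --> \oo] --> (0 : R).
Proof.
move=> vE.
have [c c0 Pc] := gauss_poly_bound P.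
apply/norm_cvg0P.
apply: (@squeeze_cvgr _ _ _ _ (cst 0)
  (fun n : nat => c * expR (- (n%:R ^+ 2 / 8)))).
- apply: nearW => n; rewrite normr_ge0/= (le_trans (Pc _))//.
  by rewrite vE.
- exact: cvg_cst.
- rewrite -[X in _ --> X](mulr0 c); apply: cvgMr.
  apply: (cvg_comp (fun n : nat => n%:R ^+ 2 / 8 : R) (fun x => expR (- x)));
    last exact: cvgr_expR.
  apply: (cvg_comp (fun n => n%:R : R) (fun x => x ^+ 2 / 8));
    first exact: cvgr_idn.
  by apply: gt0_cvgMly; [rewrite invr_gt0|exact: cvgr_expr2].
Qed.

Definition gauss_int P : R := \int[mu]_x gauss_poly P x.

Lemma gauss_polyD P Q : gauss_poly (P + Q) = gauss_poly P \+ gauss_poly Q.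
Proof. by apply/funext => x; rewrite /gauss_poly hornerD mulrDl. Qed.

Lemma gauss_polyZ a P : gauss_poly (a *: P) = a \*o gauss_poly P.
Proof. by apply/funext => x; rewrite /gauss_poly/= hornerZ mulrA. Qed.

Lemma gauss_intD P Q : gauss_int (P + Q) = gauss_int P + gauss_int Q.
Proof.
rewrite /gauss_int gauss_polyD RintegralD//; exact: integrable_gauss_poly.
Qed.

Lemma gauss_intZ a P : gauss_int (a *: P) = a * gauss_int P.
Proof. rewrite /gauss_int gauss_polyZ RintegralZl//; exact: integrable_gauss_poly. Qed.

Lemma gauss_int0 : gauss_int 0 = 0.
Proof. by rewrite -(scale0r 0) gauss_intZ mul0r. Qed.

(** Integration by parts against the Gaussian: the integrand of the difference is
    the derivative of a function that vanishes at both infinities. *)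
Lemma gauss_int_deriv P : gauss_int P^`() = gauss_int ('X * P).
Proof.
apply/eqP; rewrite -subr_eq0 -mulN1r -gauss_intZ scaleN1r -gauss_intD.
rewrite /gauss_int (integral_derivativeT (is_derive_gauss_poly P)
  (@continuous_gauss_poly _) (integrable_gauss_poly _) (a := 0) (b := 0)) ?subrr//; apply: cvg_gauss_poly => // n.
by rewrite sqrrN.
Qed.

(** Substitution holds for nonnegative continuous functions; it is applied to the
    positive and the negative part of [G], which are again continuous. *)
Lemma integral_affine (G : R -> R) (a b : R) : 0 < a -> continuous G ->
  mu.-integrable setT (EFin \o (fun x => G (a * x + b))) ->
  \int[mu]_v G v = a * \int[mu]_x G (a * x + b).
Proof.
move=> a0 cG iG.
pose F (x : R) := a * x + b.
have dF x : is_derive x (1 : R) F a.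
  by rewrite /F; apply: trigger_derive; rewrite addr0 scaler1.
have F'E : F^`()%classic = cst a.
  by apply/funext => x; rewrite derive1E; apply: derive_val.
have cF : continuous F.
  by move=> x; apply/differentiable_continuous/derivable1_diffP; have [] := dF x.
have FE : F = fun x => (x + b / a) * a.
  by apply/funext => x; rewrite /F; field; rewrite gt_eqF.
have sub (H : R -> R) : continuous H -> (forall x, 0 <= H x) ->
    (\int[mu]_x (H x)%:E = \int[mu]_x (a * H (F x))%:E)%E.
  move=> cH H0.
  rewrite (@increasing_ge0_integration_by_substitutionT _ F)//.
  - by apply: eq_integral => x _; rewrite F'E/= mulrC.
  - by move=> x y xy; rewrite /F ltrD2r ltr_pM2l.
  - by rewrite F'E => ?; exact: cvg_cst.
  - by rewrite F'E; exact: is_cvg_cst.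
  - by rewrite F'E; exact: is_cvg_cst.
  - rewrite FE; apply/gt0_cvgMlNy => //; exact: cvg_addrr_Ny.
  - rewrite FE; apply/gt0_cvgMly => //; exact: cvg_addrr.
rewrite -RintegralZl//.
rewrite /Rintegral; congr fine.
have cpos (H : R -> R) : continuous H -> continuous (fun x => Num.max (H x) 0).
  by move=> cH x; apply: continuous_max; [exact: cH|exact: cst_continuous].
have max_ge0 (y : R) : 0 <= Num.max y 0 by rewrite le_max lexx orbT.
rewrite integralE [RHS]integralE; congr (_ - _)%E.
- transitivity (\int[mu]_x (Num.max (G x) 0)%:E)%E.
    by apply: eq_integral => x _; rewrite funeposE EFin_max.
  rewrite sub; [|exact: cpos|by []].
  apply: eq_integral => x _; rewrite funeposE -EFin_max; congr EFin.
  by rewrite maxr_pMr ?mulr0// ltW.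
- transitivity (\int[mu]_x (Num.max (- G x) 0)%:E)%E.
    by apply: eq_integral => x _; rewrite funenegE EFin_max.
  rewrite sub; [| |by []].
  + apply: eq_integral => x _; rewrite funenegE -EFinN -EFin_max; congr EFin.
    by rewrite maxr_pMr ?mulr0 ?mulrN// ltW.
  + by apply: cpos => x; apply: cvgN; exact: cG.
Qed.

(** * Hermite functions and their moments *)

Fixpoint hermite_poly (n : nat) : {poly R} :=
  if n is k.+1 then 2 *: ('X * hermite_poly k) - (hermite_poly k)^`() else 1.

(** Taken together with the recursion that defines the polynomials, this is the
    classical three-term recurrence. *)
Lemma deriv_hermite_poly n : (hermite_poly n)^`() = (2 * n%:R) *: hermite_poly n.-1.
Proof.
case: n => [|n]; first by rewrite mulr0 scale0r derivC.
elim: n => [|n IH] /=.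
  by rewrite derivC subr0 mulr1 derivZ derivX mulr1.
rewrite -/(hermite_poly n.+1).
rewrite derivB derivZ derivM derivX mul1r IH /= derivZ.
rewrite -!mul_polyC -[in n.+2%:R]natr1 !polyCM polyCD polyC1; ring.
Qed.

(** Differentiating [(-1)^n h exp (-x^2)] replaces [h] by [2 x h - h'] and flips
    the sign: the Rodrigues formula satisfies the recursion of
    [hermite_poly]. *)
Lemma derive1n_gauss n : ((fun y : R => expR (- y ^+ 2))^`(n))%classic =
  fun x => (-1) ^+ n * (hermite_poly n).[x] * expR (- x ^+ 2).
Proof.
elim: n => [|n IH]; first by apply/funext => x; rewrite /= !hornerE.
rewrite derive1nS IH; apply/funext => x /=.
rewrite derive1E; apply: derive_val.
apply: trigger_derive.
by rewrite !hornerE /= [in RHS]exprS /GRing.scale /=; ring.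
Qed.

Lemma hermiteE n x : hermite n x = (hermite_poly n).[x].
Proof.
rewrite /hermite derive1n_gauss.
rewrite mulrACA -!mulrA -expRD subrr expR0 mulr1 mulrA -exprMn.
by rewrite mulrNN mulr1 expr1n mul1r.
Qed.

(** The coefficient of the raising and lowering operators of the quantum harmonic
    oscillator, in the normalization where [x] is their sum. *)
Definition ladder (n : nat) : R := Num.sqrt (n%:R / 2).

Definition psi_poly (n : nat) : {poly R} :=
  (Num.sqrt (Num.sqrt pi * 2 ^+ n * (n`!)%:R))^-1 *: hermite_poly n.

Lemma ladder0 : ladder 0 = 0.
Proof. by rewrite /ladder mul0r sqrtr0. Qed.

Lemma sqr_ladder n : ladder n ^+ 2 = n%:R / 2.
Proof. by rewrite /ladder sqr_sqrtr// divr_ge0. Qed.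

Lemma psiE n : psi n = gauss_poly (psi_poly n).
Proof.
by apply/funext => x; rewrite /psi /gauss_poly hornerZ hermiteE.
Qed.

Lemma psi_intE n : psi_int n = gauss_int (psi_poly n).
Proof. by rewrite /psi_int psiE. Qed.

Lemma psi_normalization n :
  (Num.sqrt (Num.sqrt pi * 2 ^+ n * (n`!)%:R))^-1 =
  2 * ladder n.+1 * (Num.sqrt (Num.sqrt pi * 2 ^+ n.+1 * (n.+1`!)%:R))^-1 :> R.
Proof.
set A := Num.sqrt pi * 2 ^+ n * n`!%:R.
have -> : Num.sqrt pi * 2 ^+ n.+1 * (n.+1)`!%:R = (2 * n.+1%:R) * A.
  by rewrite /A exprS factS natrM; ring.
have -> : 2 * ladder n.+1 = Num.sqrt (2 * n.+1%:R).
  have -> : 2 * n.+1%:R = 2 ^+ 2 * (n.+1%:R / 2) :> R by field.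
  by rewrite sqrtrM ?sqr_ge0// sqrtr_sqr ger0_norm.
by rewrite (@sqrtrM _ (2 * n.+1%:R) A) ?mulr_ge0// invfM mulrA divff ?mul1r.
Qed.

(** Here and below, a predecessor at [n = 0] is harmless because [ladder 0 = 0]. *)
Lemma deriv_psi_poly n : (psi_poly n)^`() = (2 * ladder n) *: psi_poly n.-1.
Proof.
rewrite /psi_poly derivZ deriv_hermite_poly.
case: n => [|n]; first by rewrite ladder0 !mulr0 !scale0r scaler0.
rewrite [in RHS]psi_normalization !scalerA; congr (_ *: _).
have -> : n.+1%:R = 2 * ladder n.+1 ^+ 2 by rewrite sqr_ladder; field.
ring.
Qed.

(** The recursion of the Hermite polynomials says that raising is multiplication
    by the variable minus half of the derivative. *)
Lemma mulX_psi_poly n :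
  'X * psi_poly n = ladder n *: psi_poly n.-1 + ladder n.+1 *: psi_poly n.+1.
Proof.
have -> : ladder n *: psi_poly n.-1 = 2^-1 *: (psi_poly n)^`().
  by rewrite deriv_psi_poly [RHS]scalerA mulKf.
rewrite /psi_poly derivZ psi_normalization /= -!mul_polyC.
rewrite !polyCM.
(* The inverse of 2 is an opaque constant polynomial for [ring]. *)
have : (2^-1)%:P * 2%:P = 1 :> {poly R} by rewrite -polyCM mulVf.
set b := (2^-1)%:P; set c := 2%:P => bc.
set d := (Num.sqrt _)^-1%:P; set l := (ladder _)%:P; set h := hermite_poly n.
have -> : b * (c * l * d * h^`()) = b * c * (l * d * h^`()) by ring.
by rewrite bc; ring.
Qed.

(** The integral of the derivative of [psi n] vanishes, and this derivative is
    the difference of the two neighbours weighted by [ladder]. *)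
Lemma psi_int_rec n : ladder n * psi_int n.-1 = ladder n.+1 * psi_int n.+1.
Proof.
have := gauss_int_deriv (psi_poly n).
rewrite mulX_psi_poly deriv_psi_poly gauss_intD !(gauss_intZ _ (psi_poly _)).
rewrite -!psi_intE; lra.
Qed.

(** At [n = 0] the recurrence gives [psi_int 1 = 0], and it then propagates in
    steps of two. *)
Lemma psi_int_odd n : odd n -> psi_int n = 0 :> R.
Proof.
have l0 k : ladder k.+1 != 0 by rewrite gt_eqF// sqrtr_gt0 divr_gt0.
have step k : psi_int k = 0 :> R -> psi_int k.+2 = 0 :> R.
  move=> i0; have /esym/eqP := psi_int_rec k.+1.
  by rewrite i0 mulr0 mulf_eq0 (negbTE (l0 k.+1)) => /eqP.
have i1 : psi_int 1 = 0 :> R.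
  have /esym/eqP := psi_int_rec 0.
  by rewrite ladder0 mul0r mulf_eq0 (negbTE (l0 0)) => /eqP.
move=> on; have -> : n = n./2.*2.+1 by rewrite -[LHS]odd_double_half on.
elim: n./2 => [|k IH]; first exact: i1.
by rewrite doubleS; apply: step; exact: IH.
Qed.

(** The integral of [(al * xi + u) * psi n xi]: by [gauss_int_deriv] and
    [deriv_psi_poly], the integral of [xi * psi n xi] equals
    [2 * ladder n * psi_int n.-1]. *)
Definition first_moment (al u : R) (n : nat) : R :=
  al * (2 * ladder n * psi_int n.-1) + u * psi_int n.

Lemma integral_velocity_psi (al u : R) (N : nat) (c : 'I_N -> R) : 0 < al ->
  \int[mu]_v (v * \sum_(n < N) c n * psi n ((v - u) / al)) =
  al * \sum_(n < N) c n * first_moment al u n.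
Proof.
move=> al0.
pose P := (al *: 'X + u%:P) * \sum_(n < N) c n *: psi_poly n.
have al_neq0 : al != 0 by rewrite gt_eqF.
have GE v : v * \sum_(n < N) c n * psi n ((v - u) / al) =
    gauss_poly P ((v - u) / al).
  rewrite /P /gauss_poly !hornerE /= horner_sum -[RHS]mulrA.
  congr (_ * _); first by field.
  rewrite mulr_suml; apply: eq_bigr => n _.
  by rewrite psiE /gauss_poly [in RHS]hornerZ mulrA.
have unscale x : (al * x + u - u) / al = x by field.
under eq_Rintegral do rewrite GE.
rewrite (@integral_affine (fun v => gauss_poly P ((v - u) / al)) al u)//; last 2 first.
- move=> x; apply: (@continuous_comp _ _ _ (fun v => (v - u) / al));
    last exact: continuous_gauss_poly.
  by apply: cvgM; [apply: cvgB; [exact: cvg_id|exact: cvg_cst]|exact: cvg_cst].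
- under eq_fun do rewrite unscale.
  exact: integrable_gauss_poly.
under eq_Rintegral do rewrite unscale.
rewrite -/(gauss_int P); congr (_ * _).
rewrite /P mulr_sumr.
rewrite (big_morph gauss_int gauss_intD gauss_int0); apply: eq_bigr => n _.
rewrite -scalerAr gauss_intZ mulrDl -scalerAl mul_polyC gauss_intD.
rewrite !(gauss_intZ _ (psi_poly _)).
rewrite gauss_intZ -gauss_int_deriv deriv_psi_poly !(gauss_intZ _ (psi_poly _)).
by rewrite -!psi_intE.
Qed.

End GaussianPolynomials.

(** * Moments along the mode hierarchy *)

Section Telescoping.
Context {R : realType}.
Implicit Types (al u : R).

(** Integration by parts in disguise: the left-hand side is minus the integral of
    [(al * xi + u)] times the derivative of [psi n]. In terms of [psi_int], the
    [u] part cancels by [psi_int_rec] and the [al] part is a difference of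
    squares of ladder coefficients, which are in arithmetic progression. *)
Lemma ladder_first_moment al u n :
  ladder n.+1 * first_moment al u n.+1 - ladder n * first_moment al u n.-1 =
  al * psi_int n.
Proof.
have a1 := sqr_ladder (R := R) n.+1.
have r1 := psi_int_rec (R := R) n.
rewrite /first_moment.
have -> : ladder n * (al * (2 * ladder n.-1 * psi_int n.-1.-1) + u * psi_int n.-1) =
  al * (2 * ladder n ^+ 2 * psi_int n) + u * (ladder n * psi_int n.-1) :> R.
  case: n {a1 r1} => [|n]; first by rewrite ladder0; ring.
  by rewrite /= -(mulrA 2 (ladder n)) (psi_int_rec n); ring.
rewrite r1 sqr_ladder /=.
have -> : ladder n.+1 * (al * (2 * ladder n.+1 * psi_int n) + u * psi_int n.+1) =
  al * (2 * ladder n.+1 ^+ 2 * psi_int n) + u * (ladder n.+1 * psi_int n.+1) :> R by ring.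
by rewrite a1 -natr1; field.
Qed.

(** Summation by parts in the mode index. By [ladder_first_moment] the interior
    coefficients are those of the charge density, and the boundary term at [N] is
    the truncation error that drives the momentum drift; the boundary term at 0
    vanishes with [ladder 0]. *)
Lemma sum_first_moment_ladder al u N (b : nat -> R) :
  \sum_(n < N)
     first_moment al u n * (ladder n * b n.-1 - ladder n.+1 * b n.+1) =
  al * (\sum_(n < N) psi_int n * b n)
  - ladder N * (first_moment al u N * b N.-1 + first_moment al u N.-1 * b N).
Proof.
elim: N => [|N IH]; first by rewrite !big_ord0 ladder0; ring.
rewrite !big_ord_recr /= IH (mulrDr al) (mulrA al (psi_int N)).
rewrite -(ladder_first_moment al u).
ring.
Qed.

(** The boundary coefficient depends on the parity of [N], since exactly one of
    the moments of order 0 and 1 of [psi N] vanishes. *)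
Lemma ladder_first_moment_odd al u N : odd N ->
  ladder N * first_moment al u N = al * N%:R * psi_int N.-1.
Proof.
move=> oN; rewrite /first_moment (psi_int_odd oN) mulr0 addr0.
have -> : ladder N * (al * (2 * ladder N * psi_int N.-1)) =
  al * (2 * ladder N ^+ 2) * psi_int N.-1 :> R by ring.
by rewrite sqr_ladder; congr (_ * _ * _); field.
Qed.

Lemma ladder_first_moment_even al u N : (0 < N)%N -> ~~ odd N ->
  ladder N * first_moment al u N = u * (ladder N.-1 * psi_int N.-2).
Proof.
case: N => [//|N] _ /= /negPn oN.
by rewrite /first_moment /= (psi_int_odd oN) psi_int_rec; ring.
Qed.
End Telescoping.

(** * The periodic centered difference matrix *)

Section CenteredDifferenceTheory.
Context {R : realType}.
Variables (p Nx : nat) (dx : R).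
Hypotheses (p_even : ~~ odd p) (p_lt : (p < Nx)%N).

(** As [p < Nx], the two halves of the stencil do not overlap. The residue takes
    care of [i = 0], where the coefficient is 0. *)
Lemma fd_coefN i : (i < Nx)%N ->
  fd_coef p Nx dx ((Nx - i) %% Nx) = - fd_coef p Nx dx i.
Proof.
move=> iN; have pE : p = p./2.*2 by rewrite even_halfK.
rewrite /fd_coef; case: i iN => [|i] iN.
  rewrite subn0 modnn /= subn0 (_ : (0 < Nx <= p./2)%N = false) ?oppr0//; lia.
rewrite modn_small; last by lia.
rewrite subKn; last by lia.
have : ~~ ((1 <= Nx - i.+1 <= p./2) && (1 <= i.+1 <= p./2))%N by lia.
by case: (1 <= Nx - _ <= _)%N; case: (1 <= i.+1 <= _)%N; rewrite ?opprK ?oppr0.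
Qed.

Lemma modn_reflect (k j : nat) : (j < Nx)%N -> (k < Nx)%N ->
  ((k + Nx - j) %% Nx = if j <= k then k - j else k + Nx - j)%N.
Proof.
move=> jN kN; case: leqP => jk; last by rewrite modn_small//; lia.
by rewrite -addnBAC// modnDr modn_small//; lia.
Qed.

Lemma trmx_fd_mx : (fd_mx p Nx dx)^T = - fd_mx p Nx dx.
Proof.
apply/matrixP => j k; rewrite !mxE -fd_coefN ?ltn_pmod//; last by lia.
congr (fd_coef _ _ _ _); have := ltn_ord j; have := ltn_ord k.
move=> kN jN; rewrite !modn_reflect//.
case: (ltngtP j k) => jk.
- by rewrite modn_small; lia.
- by rewrite modn_small; lia.
- by rewrite jk subnn subn0 modnn.
Qed.

(** All columns have the same sum, that of the stencil, because the reflection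
    [j -> k - j] modulo [Nx] is an involution; and the stencil is odd. *)
Lemma sum_fd_mx_col : (const_mx 1 : 'cV[R]_Nx)^T *m fd_mx p Nx dx = 0.
Proof.
have colE (k : 'I_Nx) : \sum_(j < Nx) fd_coef p Nx dx ((k + Nx - j) %% Nx) =
    \sum_(i < Nx) fd_coef p Nx dx i.
  have N0 : (0 < Nx)%N by lia.
  pose f (j : 'I_Nx) := Ordinal (ltn_pmod (k + Nx - j) N0).
  rewrite [RHS](reindex_inj (h := f))//.
  apply: inv_inj => j; apply/val_inj => /=; have := ltn_ord j; have := ltn_ord k.
  move=> kN jN; rewrite [X in (_ - X)%N]modn_reflect//.
  case: leqP => jk; rewrite modn_reflect//; case: leqP; lia.
have S0 : \sum_(i < Nx) fd_coef p Nx dx i = 0.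
  have N0 : (0 < Nx)%N by lia.
  have := colE (Ordinal N0).
  under eq_bigr do rewrite /= add0n fd_coefN//.
  rewrite sumrN; lra.
apply/rowP => k; rewrite !mxE -[RHS]S0 -(colE k).
by apply: eq_bigr => j _; rewrite !mxE mul1r.
Qed.

(** The self-force vanishes: this is the only way in which the Poisson equation
    enters the momentum balance. *)
Lemma fd_mx_quad0 (E : 'cV[R]_Nx) : (E^T *m (fd_mx p Nx dx *m E)) 0 0 = 0.
Proof.
set X := E^T *m _.
have : X^T = - X by rewrite /X !trmx_mul trmxK trmx_fd_mx mulmxN mulNmx mulmxA.
move=> /matrixP/(_ 0 0); rewrite !mxE; lra.
Qed.

End CenteredDifferenceTheory.

(** * Derivatives in time *)

Section Derivatives.
Context {R : realType}.

Lemma is_derive_fsum (I : finType) (h : I -> R -> R) (dh : I -> R) (x : R) :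
  (forall i, is_derive x (1 : R) (h i) (dh i)) ->
  is_derive x (1 : R) (fun y => \sum_i h i y) (\sum_i dh i).
Proof.
move=> hd; rewrite [X in is_derive _ _ X](_ : _ = \sum_i h i); last first.
  by apply/funext => y; rewrite fct_sumE.
by elim/big_ind2 : _ => // [|] *; [exact: is_derive_cst|exact: is_deriveD].
Qed.

Lemma is_derive_mulrl (k : R) (f : R -> R) (df x : R) :
  is_derive x (1 : R) f df -> is_derive x (1 : R) (fun y => k * f y) (k * df).
Proof. exact: is_deriveZ. Qed.

Lemma is_derive_mx_coord m n (M : R -> 'M[R]_(m, n)) (D : 'M[R]_(m, n)) (x : R)
    i j :
  is_derive x (1 : R) M D -> is_derive x (1 : R) (fun y => M y i j) (D i j).
Proof.
case=> dM <-; apply: DeriveDef; first exact: (derivable_mxP _ _ _).1.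
by rewrite derive_mx// mxE.
Qed.

Lemma is_derive0_itv_constant (f : R -> R) (J : interval R) :
  (forall t, t \in J -> is_derive t (1 : R) f 0) ->
  {in J &, forall t1 t2, f t1 = f t2}.
Proof.
move=> df t1 t2.
wlog le12 : t1 t2 / t1 <= t2.
  by move=> H t1J t2J; case: (leP t1 t2) => [|/ltW] /H ->.
move=> t1J t2J.
have sub x : x \in `[t1, t2] -> x \in J.
  by rewrite in_itv/= => x12; exact: (@interval_is_interval _ J t1 t2 t1J t2J x x12).
have [x /subset_itv_oo_cc /sub /df//||c _] := @MVT_segment _ f (cst 0) t1 t2 le12.
  apply: derivable_within_continuous => x /sub /df; by case.
by rewrite mul0r => /eqP; rewrite subr_eq0 => /eqP.
Qed.

End Derivatives.

(** * The momentum balance *)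

Section MomentumBalance.
Context {R : realType} {S : finType}.
Variables (q m u alpha : S -> R) (Nv p Nx : nat) (l : R) (J : interval R).
Variables (C : S -> int -> R -> 'cV[R]_Nx) (E : R -> 'cV[R]_Nx).
Hypotheses (m_gt0 : forall s, 0 < m s) (alpha_gt0 : forall s, 0 < alpha s).
Hypotheses (p_even : ~~ odd p) (p_ltNx : (p < Nx)%N).
Hypothesis sol : sw_solution q m u alpha Nv p l C E J.
Let dx := grid_dx Nx l.

Lemma sw_momentumE t : sw_momentum m u alpha Nv l C t =
  \sum_s m s * (dx * (alpha s * \sum_(n < Nv) first_moment (alpha s) (u s) n *
     \sum_(j < Nx) C s n%:Z t j 0)).
Proof.
apply: eq_bigr => s _; congr (_ * (_ * _)).
under eq_bigr do rewrite /f_sw integral_velocity_psi//.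
rewrite -mulr_sumr; congr (_ * _).
rewrite exchange_big; apply: eq_bigr => n _ /=.
by rewrite mulr_sumr; apply: eq_bigr => j _; rewrite mulrC.
Qed.

(** Summing over the periodic grid removes the advection term, leaving the
    acceleration by the electric field. *)
Lemma sum_sw_rhs s n t : \sum_(j < Nx) sw_rhs q m u alpha p l C E s n t j 0 =
  \sum_(j < Nx) q s / (m s * alpha s) * (E t j 0 *
    (ladder n * C s n.-1%:Z t j 0 - ladder n.+1 * C s n.+1%:Z t j 0)).
Proof.
pose one := (const_mx 1 : 'cV[R]_Nx).
have sumE (w : 'cV[R]_Nx) : \sum_(j < Nx) w j 0 = (one^T *m w) 0 0.
  by rewrite mxE; apply: eq_bigr => j _; rewrite !mxE mul1r.
rewrite sumE /sw_rhs mulmxDr mulmxN mulmxA sum_fd_mx_col// mul0mx oppr0 add0r.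
rewrite -sumE; apply: eq_bigr => j _; rewrite !mxE.
congr (_ * (_ * (_ - _ * _))); last by rewrite intS addrC.
by case: n => [|n]; [rewrite ladder0 !mul0r sqrtr0 mul0r|rewrite intS addrAC subrr add0r].
Qed.

(** The first term is the force on the charge density of the species, which
    cancels only after summing over the species; the second is the truncation
    error. *)
Lemma species_momentum_rate s t : t \in J ->
  m s * (dx * (alpha s * \sum_(n < Nv) first_moment (alpha s) (u s) n *
     \sum_(j < Nx) sw_rhs q m u alpha p l C E s n t j 0)) =
  dx * ((E t)^T *m ((q s * alpha s) *: \sum_(n < Nv) psi_int n *: C s n%:Z t)) 0 0
  - dx * (q s * (ladder Nv * first_moment (alpha s) (u s) Nv) *
      ((E t)^T *m C s (Nv%:Z - 1) t) 0 0).
Proof.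
move=> tJ.
pose b j n := C s n%:Z t j 0.
have bNv j : b j Nv = 0 by rewrite /b (sw_modeNv sol)// mxE.
have bNv1 j : ladder Nv * C s (Nv%:Z - 1) t j 0 = ladder Nv * b j Nv.-1.
  rewrite /b; case: (Nv) => [|n]; first by rewrite ladder0 !mul0r.
  by rewrite intS addrAC subrr add0r.
have ms0 : m s != 0 by rewrite gt_eqF.
have als0 : alpha s != 0 by rewrite gt_eqF.
transitivity (dx * (q s * \sum_(j < Nx) E t j 0 *
    (alpha s * (\sum_(n < Nv) psi_int n * b j n) -
     ladder Nv * (first_moment (alpha s) (u s) Nv * b j Nv.-1)))).
  under eq_bigr do rewrite sum_sw_rhs mulr_sumr.
  rewrite exchange_big /=.
  set X := \sum_(j < Nx) E t j 0 * _.
  have -> : dx * (q s * X) = m s * (dx * (alpha s * (q s / (m s * alpha s) * X))).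
    by field; rewrite ms0 als0.
  congr (_ * (_ * (_ * _))); rewrite mulr_sumr; apply: eq_bigr => j _.
  have := sum_first_moment_ladder (alpha s) (u s) Nv (b j).
  rewrite bNv mulr0 addr0 => <-.
  by rewrite !mulr_sumr; apply: eq_bigr => n _; rewrite /b; ring.
rewrite -mulrBr; congr (_ * _).
rewrite !mxE !mulr_sumr -sumrB; apply: eq_bigr => j _.
rewrite !mxE summxE.
under [in RHS]eq_bigr do rewrite mxE.
set Y := \sum_(n < Nv) _.
have -> : q s * (ladder Nv * first_moment (alpha s) (u s) Nv) *
    (E t j 0 * C s (Nv%:Z - 1) t j 0) =
  q s * first_moment (alpha s) (u s) Nv * E t j 0 *
    (ladder Nv * C s (Nv%:Z - 1) t j 0) by ring.
by rewrite bNv1; ring.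
Qed.

Lemma sw_momentum_is_derive t : t \in J ->
  is_derive t (1 : R) (sw_momentum m u alpha Nv l C)
    (- (dx * \sum_s q s * (ladder Nv * first_moment (alpha s) (u s) Nv) *
        ((E t)^T *m C s (Nv%:Z - 1) t) 0 0)).
Proof.
move=> tJ.
have -> : sw_momentum m u alpha Nv l C = fun t' =>
  \sum_s m s * (dx * (alpha s * \sum_(n < Nv) first_moment (alpha s) (u s) n *
     \sum_(j < Nx) C s n%:Z t' j 0)) by apply/funext => t'; exact: sw_momentumE.
have dM := is_derive_fsum (fun s => is_derive_mulrl (m s) (is_derive_mulrl dx
  (is_derive_mulrl (alpha s) (is_derive_fsum (fun n : 'I_Nv =>
    is_derive_mulrl (first_moment (alpha s) (u s) n)
      (is_derive_fsum (fun j : 'I_Nx =>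
        is_derive_mx_coord j 0 (sw_vlasov sol s (ltn_ord n) tJ)))))))).
apply: trigger_derive dM _.
under eq_bigr do rewrite species_momentum_rate//.
rewrite sumrB -!mulr_sumr -summxE -mulmx_sumr -(sw_poisson sol tJ).
by rewrite fd_mx_quad0// mulr0 sub0r.
Qed.

End MomentumBalance.

Theorem theorem5 (R : realType) (S : finType) (q m u alpha : S -> R)
    (Nv p Nx : nat) (l : R) (J : interval R)
    (C : S -> int -> R -> 'cV[R]_Nx) (E : R -> 'cV[R]_Nx)
    (m_gt0 : forall s, 0 < m s) (alpha_gt0 : forall s, 0 < alpha s)
    (Nv_ge1 : (1 <= Nv)%N) (p_even : ~~ odd p) (p_ltNx : (p < Nx)%N)
    (l_gt0 : 0 < l) (J_open : open [set` J])
    (sol : sw_solution q m u alpha Nv p l C E J) :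
  (~~ odd Nv -> (forall s, u s = 0) ->
     forall t1 t2, t1 \in J -> t2 \in J ->
       sw_momentum m u alpha Nv l C t1 = sw_momentum m u alpha Nv l C t2)
  /\
  (forall t, t \in J ->
     is_derive t (1 : R) (sw_momentum m u alpha Nv l C)
       (if odd Nv then
          - (grid_dx Nx l * Nv%:R * psi_int Nv.-1 *
             ((E t)^T *m (\sum_s (alpha s * q s) *: C s (Nv%:Z - 1) t)) 0 0)
        else
          - (grid_dx Nx l * Num.sqrt (Nv.-1%:R / 2) * psi_int Nv.-2 *
             ((E t)^T *m (\sum_s (u s * q s) *: C s (Nv%:Z - 1) t)) 0 0))).


Proof.
have dP t (tJ : t \in J) := sw_momentum_is_derive m_gt0 alpha_gt0 p_even p_ltNx sol tJ.
split=> [Nv_even u0|t tJ].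
  apply: is_derive0_itv_constant => t tJ.
  apply: trigger_derive (dP t tJ) _.
  rewrite big1 ?mulr0 ?oppr0// => s _.
  by rewrite ladder_first_moment_even// u0 mul0r mulr0 mul0r.
apply: trigger_derive (dP t tJ) _.
case: ifPn => Nv_odd; congr (- _); rewrite mulmx_sumr summxE;
  rewrite -(mulrA (grid_dx Nx l)) -(mulrA (grid_dx Nx l)); congr (_ * _);
  rewrite !mulr_sumr; apply: eq_bigr => s _; rewrite -scalemxAr [in RHS]mxE.
- by rewrite ladder_first_moment_odd//; ring.
- by rewrite ladder_first_moment_even// -/(ladder _); ring.
Qed.
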